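(* Let $(U,A,s^\ell,t^\ell,\Delta,\epsilon)$ be a right Hopf left bialgebroid. The following assertions are equivalent: (i) The extension $s^\ell:A\to U$ is separable, i.e. the multiplication map $m: U_{\blacktriangleleft}\otimes_A {}_{\triangleright}U\to U$ splits as a map of $U^e$-modules (where $U^e=U\otimes_k U^{op}$, i.e. $U$-$U$-bimodules). (ii) There exists a normalized left integral, that is, an element $l\in\int_U^\ell$ such that $\epsilon(l)=1$. (iii) The map $\epsilon:U\to A$ splits as a left $U$-module map. (iv) Any (left) $U$-module is projective.
   Context: Let $k$ be a commutative ring and $A$ an associative unital $k$-algebra. A left bialgebroid $(U,A,s^\ell,t^\ell,\Delta,\epsilon)$ is a unital $k$-algebra $U$ with $k$-algebra maps $s^\ell:A\to U$, $t^\ell:A^{op}\to U$ whose images commute; write $a\triangleright u=s^\ell(a)u$, $u\triangleleft a=t^\ell(a)u$, $a\blacktriangleright u=u\,t^\ell(a)$, $u\blacktriangleleft a=u\,s^\ell(a)$ (a subscript symbol on $U$ indicates the $A$-module structure used), together with an $A$-coring structure $\Delta:U\to U_{\triangleleft}\otimes_A{}_{\triangleright}U$, $u\mapsto u_{(1)}\otimes u_{(2)}$, $\epsilon:U\to A$ on the $A$-bimodule ${}_{\triangleright}U_{\triangleleft}$ (bimodule maps, coassociative, $s^\ell(\epsilon(u_{(1)}))u_{(2)}=u=t^\ell(\epsilon(u_{(2)}))u_{(1)}$), such that $\Delta$ is a unital algebra morphism with values in $\{\sum u_i\otimes u_i' : \sum u_it^\ell(a)\otimes u_i'=\sum u_i\otimes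 u_i's^\ell(a)\ \forall a\in A\}$, $\epsilon(1)=1$ and $\epsilon(uu')=\epsilon(u\,s^\ell(\epsilon(u')))=\epsilon(u\,t^\ell(\epsilon(u')))$. Here $U_{\triangleleft}\otimes_A{}_{\triangleright}U$ is the quotient of $U\otimes_kU$ by $t^\ell(a)u\otimes v=u\otimes s^\ell(a)v$, and $U_{\blacktriangleleft}\otimes_A{}_{\triangleright}U$ the quotient by $us^\ell(a)\otimes v=u\otimes s^\ell(a)v$. $U$ is a right Hopf left bialgebroid if $\alpha_r:U_{\blacktriangleleft}\otimes_A{}_{\triangleright}U\to U_{\triangleleft}\otimes_A{}_{\triangleright}U$, $u\otimes v\mapsto u_{(1)}v\otimes u_{(2)}$, is bijective. $A$ is a left $U$-module via $u(a)=\epsilon(us^\ell(a))$. The set of left integrals is $\int_U^\ell=\{u_0\in U: uu_0=s^\ell(\epsilon(u))u_0\ \forall u\in U\}$.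
   Formalization: In (iv), ''projective'' is read as projective relative to s: A→U (lifting along U-module surjections that split over A); with absolute projectivity the claim fails, e.g. for k=A=U=ℤ and the module ℤ/2. *)

(* Defs.v *)
(* MathComp world; boolp is used only to form classical quotient types. *)
From HB Require Import structures.
From mathcomp Require Import all_boot all_order all_algebra.
From mathcomp Require Import boolp.

Set Implicit Arguments.
Unset Strict Implicit.
Unset Printing Implicit Defensive.

Import GRing.Theory.
Local Open Scope ring_scope.
Local Open Scope quotient_scope.

(* [tensor ra la] is the quotient of the free abelian group on M * N by the
   biadditivity relations and  ra m a (x) n = m (x) la a n.  A finite sequence
   of pairs stands for the formal sum of its entries; negatives need no
   separate syntax since -(m (x) n) = (-m) (x) n. *)
Section Tensor.
Variables (I : Type) (M N : zmodType) (ra : M -> I -> M) (la : I -> N -> N).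

Inductive tensor_rel : seq (M * N) -> seq (M * N) -> Prop :=
| TensorRefl x : tensor_rel x x
| TensorSym x y : tensor_rel x y -> tensor_rel y x
| TensorTrans y x z : tensor_rel x y -> tensor_rel y z -> tensor_rel x z
| TensorCat x x' y y' :
    tensor_rel x x' -> tensor_rel y y' -> tensor_rel (x ++ y) (x' ++ y')
| TensorComm x y : tensor_rel (x ++ y) (y ++ x)
| TensorDl m m' n : tensor_rel [:: (m + m', n)] [:: (m, n); (m', n)]
| TensorDr m n n' : tensor_rel [:: (m, n + n')] [:: (m, n); (m, n')]
| Tensor0l n : tensor_rel [:: (0, n)] [::]
| Tensor0r m : tensor_rel [:: (m, 0)] [::]
| TensorBal m a n : tensor_rel [:: (ra m a, n)] [:: (m, la a n)].

Definition tensor_eqv : rel (seq (M * N)) := fun x y => `[< tensor_rel x y >].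

Lemma tensor_eqvP : equiv_class_of tensor_eqv.
Proof.
split.
- by move=> x; apply/asboolP; constructor.
- by move=> x y; apply/asboolP/asboolP; apply: TensorSym.
- move=> y x z /asboolP xy /asboolP yz; apply/asboolP.
  exact: TensorTrans xy yz.
Qed.

Canonical tensor_equiv := EquivRelPack tensor_eqvP.

Definition tensor : Type := {eq_quot tensor_equiv}.
HB.instance Definition _ := Choice.copy tensor {eq_quot tensor_equiv}.

Definition tensor_of (x : seq (M * N)) : tensor :=
  \pi_({eq_quot tensor_equiv}) x.
Definition tensor_repr (x : tensor) : seq (M * N) :=
  repr (x : {eq_quot tensor_equiv}).

Lemma tensor_reprK : cancel tensor_repr tensor_of.
Proof. by move=> x; exact: (@reprK _ {eq_quot tensor_equiv}). Qed.

Lemma tensor_ofP (x y : seq (M * N)) :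
  tensor_of x = tensor_of y <-> tensor_rel x y.
Proof.
split; last by move=> ?; apply/eqmodP => /=; apply/asboolP.
by rewrite /tensor_of => /eqmodP /= /asboolP.
Qed.

Lemma tensor_quotW (P : tensor -> Prop) :
  (forall x, P (tensor_of x)) -> forall x, P x.
Proof. by move=> PP x; rewrite -[x]tensor_reprK. Qed.

Definition tensor_zero : tensor := tensor_of [::].
Definition tensor_add (x y : tensor) : tensor :=
  tensor_of (tensor_repr x ++ tensor_repr y).
Definition tensor_opp (x : tensor) : tensor :=
  tensor_of [seq (- p.1, p.2) | p <- tensor_repr x].

Lemma tensor_rel_repr x : tensor_rel (tensor_repr (tensor_of x)) x.
Proof. by apply/tensor_ofP; rewrite tensor_reprK. Qed.

Lemma tensor_addE x y :
  tensor_add (tensor_of x) (tensor_of y) = tensor_of (x ++ y).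
Proof. by apply/tensor_ofP/TensorCat; apply: tensor_rel_repr. Qed.

Lemma tensor_addA : associative tensor_add.
Proof.
elim/tensor_quotW => x; elim/tensor_quotW => y; elim/tensor_quotW => z.
by rewrite !tensor_addE catA.
Qed.

Lemma tensor_addC : commutative tensor_add.
Proof.
elim/tensor_quotW => x; elim/tensor_quotW => y; rewrite !tensor_addE.
exact/tensor_ofP/TensorComm.
Qed.

Lemma tensor_add0 : left_id tensor_zero tensor_add.
Proof. by elim/tensor_quotW => x; rewrite tensor_addE. Qed.

Lemma tensor_rel_opp (x : seq (M * N)) :
  tensor_rel ([seq (- p.1, p.2) | p <- x] ++ x) [::].
Proof.
elim: x => [|[m n] x IH] /=; first exact: TensorRefl.
set y := map _ x in IH *.
apply: (TensorTrans (y := ([:: (- m, n); (m, n)] ++ (y ++ x)))).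
  rewrite -[X in tensor_rel X _]/([:: (- m, n)] ++ (y ++ ([:: (m, n)] ++ x))).
  rewrite -[X in tensor_rel _ X]/([:: (- m, n)] ++ ([:: (m, n)] ++ (y ++ x))).
  apply: TensorCat; first exact: TensorRefl.
  rewrite !catA; apply: TensorCat; last exact: TensorRefl.
  exact: TensorComm.
rewrite -[[::]]/([::] ++ [::]); apply: TensorCat => //.
apply: TensorTrans (Tensor0l n); apply: TensorSym.
by rewrite -(addNr m); apply: TensorDl.
Qed.

Lemma tensor_addN : left_inverse tensor_zero tensor_opp tensor_add.
Proof.
elim/tensor_quotW => x; rewrite /tensor_opp.
rewrite -[X in tensor_add _ X]tensor_reprK tensor_addE.
exact/tensor_ofP/tensor_rel_opp.
Qed.

HB.instance Definition _ := GRing.isZmodule.Build tensor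
  tensor_addA tensor_addC tensor_add0 tensor_addN.

Definition tens (m : M) (n : N) : tensor := tensor_of [:: (m, n)].

Definition balanced (Z : zmodType) (f : M -> N -> Z) : Prop :=
  [/\ forall m m' n, f (m + m') n = f m n + f m' n,
      forall m n n', f m (n + n') = f m n + f m n'
    & forall m a n, f (ra m a) n = f m (la a n)].

(* The additive map induced by f, applied to x: for x = \sum_i m_i (x) n_i it is
   \sum_i f m_i n_i.  It is independent of the chosen decomposition of x when f
   is balanced (tensor_liftE), and only used for balanced f below. *)
Definition tensor_lift (Z : zmodType) (f : M -> N -> Z) (x : tensor) : Z :=
  \sum_(p <- tensor_repr x) f p.1 p.2.

Section Lift.
Variables (Z : zmodType) (f : M -> N -> Z).
Hypothesis f_bal : balanced f.

Lemma tensor_lift_rel (x y : seq (M * N)) : tensor_rel x y ->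
  \sum_(p <- x) f p.1 p.2 = \sum_(p <- y) f p.1 p.2.
Proof.
case: f_bal => fDl fDr fB.
have f0l n : f 0 n = 0 by apply: (addrI (f 0 n)); rewrite -fDl !addr0.
have f0r m : f m 0 = 0 by apply: (addrI (f m 0)); rewrite -fDr !addr0.
elim=> {x y} //.
- by move=> y x z _ -> _ ->.
- by move=> x x' y y' _ exy _ eyy; rewrite !big_cat /= exy eyy.
- by move=> x y; rewrite !big_cat /= addrC.
- by move=> m m' n; rewrite !big_cons !big_nil /= fDl addr0 addrA addr0.
- by move=> m n n'; rewrite !big_cons !big_nil /= fDr addr0 addrA addr0.
- by move=> n; rewrite big_seq1 big_nil.
- by move=> m; rewrite big_seq1 big_nil.
- by move=> m a n; rewrite !big_seq1 /= fB.
Qed.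

Lemma tensor_lift_pi (x : seq (M * N)) :
  tensor_lift f (tensor_of x) = \sum_(p <- x) f p.1 p.2.
Proof. exact/tensor_lift_rel/tensor_rel_repr. Qed.

Lemma tensor_liftE m n : tensor_lift f (tens m n) = f m n.
Proof. by rewrite tensor_lift_pi big_seq1. Qed.

Lemma tensor_liftD (x y : tensor) :
  tensor_lift f (x + y) = tensor_lift f x + tensor_lift f y.
Proof.
elim/tensor_quotW: x => x; elim/tensor_quotW: y => y.
by rewrite [_ + _]tensor_addE !tensor_lift_pi big_cat.
Qed.
End Lift.

Lemma tensDl m m' n : tens (m + m') n = tens m n + tens m' n.
Proof. by rewrite [RHS]tensor_addE; apply/tensor_ofP; constructor. Qed.

Lemma tensDr m n n' : tens m (n + n') = tens m n + tens m n'.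
Proof. by rewrite [RHS]tensor_addE; apply/tensor_ofP; constructor. Qed.

Lemma tens_bal m a n : tens (ra m a) n = tens m (la a n).
Proof. by apply/tensor_ofP; constructor. Qed.

Lemma tensor_ind (P : tensor -> Prop) :
  P 0 -> (forall m n x, P x -> P (tens m n + x)) -> forall x, P x.
Proof.
move=> P0 PD; elim/tensor_quotW; elim=> [//|[m n] x Px].
suff -> : tensor_of ((m, n) :: x) = tens m n + tensor_of x by exact: PD.
by rewrite [RHS]tensor_addE.
Qed.
End Tensor.

(* The A-tensor products below are quotients of the tensor product over k: as
   s and t are k-linear and unital, c *: u = s (c *: 1) * u, etc., so
   k-balancedness is an instance of A-balancedness. *)
Section Bialgebroid.
Variables (k : comPzRingType) (A U : algType k).

Definition tri_l (s : A -> U) (a : A) (u : U) : U := s a * u.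
Definition tri_r (t : A -> U) (u : U) (a : A) : U := t a * u.
Definition btri_r (s : A -> U) (u : U) (a : A) : U := u * s a.

Record left_bialgebroid := LeftBialgebroid {
  src : {lrmorphism A -> U};
  (* an algebra map A^op -> U *)
  tgt : {linear A -> U};
  tgt1 : tgt 1 = 1;
  tgtM : forall a b, tgt (a * b) = tgt b * tgt a;
  src_tgtC : forall a b, src a * tgt b = tgt b * src a;

  comul : {additive U -> tensor (tri_r tgt) (tri_l src)};
  counit : {additive U -> A};

  comul_src : forall a u, comul (src a * u) =
    tensor_lift (fun u1 u2 => tens _ _ (src a * u1) u2) (comul u);
  comul_tgt : forall a u, comul (tgt a * u) =
    tensor_lift (fun u1 u2 => tens _ _ u1 (tgt a * u2)) (comul u);
  counit_src : forall a u, counit (src a * u) = a * counit u;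
  counit_tgt : forall a u, counit (tgt a * u) = counit u * a;

  (* U (x) U (x) U is bracketed to the right; the left A-action on the inner
     factor U (x) U is a (x (x) y) = src a * x (x) y. *)
  comulA : forall u,
    tensor_lift
      (fun u1 u2 => tensor_lift
         (fun u11 u12 => tens (tri_r tgt)
            (fun a => tensor_lift (fun x y => tens _ _ (src a * x) y))
            u11 (tens (tri_r tgt) (tri_l src) u12 u2))
         (comul u1))
      (comul u) =
    tensor_lift
      (fun u1 u2 => tens (tri_r tgt)
         (fun a => tensor_lift (fun x y => tens _ _ (src a * x) y))
         u1 (comul u2))
      (comul u);
  comul_counitl : forall u,
    tensor_lift (fun u1 u2 => src (counit u1) * u2) (comul u) = u;
  comul_counitr : forall u,
    tensor_lift (fun u1 u2 => tgt (counit u2) * u1) (comul u) = u;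

  comul_takeuchi : forall u a,
    tensor_lift (fun u1 u2 => tens (tri_r tgt) (tri_l src) (u1 * tgt a) u2)
      (comul u) =
    tensor_lift (fun u1 u2 => tens _ _ u1 (u2 * src a)) (comul u);
  comul1 : comul 1 = tens _ _ 1 1;
  (* The factorwise product (x (x) x') (y (x) y') = x y (x) x' y' is well
     defined when its left factor is in the subset given by comul_takeuchi. *)
  comulM : forall u v, comul (u * v) =
    tensor_lift (fun v1 v2 =>
      tensor_lift (fun u1 u2 => tens _ _ (u1 * v1) (u2 * v2)) (comul u))
      (comul v);

  counit1 : counit 1 = 1;
  counitM_src : forall u v, counit (u * v) = counit (u * src (counit v));
  counitM_tgt : forall u v, counit (u * v) = counit (u * tgt (counit v)) }.

Variable H : left_bialgebroid.
Local Notation s := (src H).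
Local Notation t := (tgt H).

Lemma tens_kbalanced (c : k) u v :
  tens (tri_r t) (tri_l s) (c *: u) v = tens (tri_r t) (tri_l s) u (c *: v).
Proof.
have -> : c *: u = tri_r t u c%:A by rewrite /tri_r linearZ /= tgt1 mulr_algl.
by rewrite tens_bal /tri_l rmorph_alg mulr_algl.
Qed.

Definition alpha_r :
    tensor (btri_r s) (tri_l s) -> tensor (tri_r t) (tri_l s) :=
  tensor_lift (fun u v =>
    tensor_lift (fun u1 u2 => tens _ _ (u1 * v) u2) (comul H u)).

Definition right_hopf : Prop := bijective alpha_r.

Definition left_integral (u0 : U) : Prop :=
  forall u, u * u0 = s (counit H u) * u0.

Definition base_act (u : U) (a : A) : A := counit H (u * s a).

Lemma base_actA u v a : base_act u (base_act v a) = base_act (u * v) a.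
Proof. by rewrite /base_act -counitM_src mulrA. Qed.

Lemma base_act1 : left_id 1 base_act.
Proof.
by move=> a; rewrite /base_act mul1r -[s a]mulr1 counit_src counit1 mulr1.
Qed.

Lemma base_actDr : right_distributive base_act +%R.
Proof. by move=> u a b; rewrite /base_act raddfD mulrDr raddfD. Qed.

Lemma base_actDl a : {morph base_act^~ a : u v / u + v}.
Proof. by move=> u v; rewrite /base_act mulrDl raddfD. Qed.

End Bialgebroid.

(* A with its left U-module structure u(a) = counit (u * src a). *)
Definition base_module (k : comPzRingType) (A U : algType k)
  (H : left_bialgebroid A U) : Type := A.

HB.instance Definition _ (k : comPzRingType) (A U : algType k)
  (H : left_bialgebroid A U) := GRing.Zmodule.on (base_module H).
HB.instance Definition _ (k : comPzRingType) (A U : algType k)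
  (H : left_bialgebroid A U) := GRing.Zmodule_isLmodule.Build U (base_module H)
    (@base_actA _ _ _ H) (@base_act1 _ _ _ H)
    (@base_actDr _ _ _ H) (@base_actDl _ _ _ H).

Section Extension.
Variables (k : comPzRingType) (A U : algType k) (f : {lrmorphism A -> U}).

Definition ext_tensor : Type := tensor (btri_r f) (tri_l f).

Definition ext_lact (u : U) : ext_tensor -> ext_tensor :=
  tensor_lift (fun x y => tens _ _ (u * x) y).
Definition ext_ract (z : ext_tensor) (v : U) : ext_tensor :=
  tensor_lift (fun x y => tens _ _ x (y * v)) z.
Definition ext_mul : ext_tensor -> U := tensor_lift (fun x y => x * y).

Definition separable_extension : Prop :=
  exists sigma : {additive U -> ext_tensor},
    [/\ forall u x, sigma (u * x) = ext_lact u (sigma x),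
        forall x v, sigma (x * v) = ext_ract (sigma x) v
      & cancel sigma ext_mul].

(* Projectivity relative to the extension f : A -> U, i.e. lifting along the
   surjections of U-modules that split over A.  Absolute projectivity of every
   U-module does not follow from separability of the extension: for
   U = A = k = int with all structure maps identities, the extension is
   separable, but int/2 is not projective. *)
Definition relatively_projective (M : lmodType U) : Prop :=
  forall (N P : lmodType U) (p : {linear N -> P}) (j : {additive P -> N}),
    (forall a y, j (f a *: y) = f a *: j y) -> cancel j p ->
  forall g : {linear M -> P}, exists h : {linear M -> N}, p \o h =1 g.

End Extension.

Definition counit_splits (k : comPzRingType) (A U : algType k)
    (H : left_bialgebroid A U) : Prop :=
  exists sigma : {linear base_module H -> U^o},
    forall a, counit H (sigma a) = a.

(* Main.v *)
(* A separability element is e = \sum_i x_i (x) y_i in U (x)_A U with u e = e u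
   for all u and \sum_i x_i y_i = 1.  Given such an e, l = \sum_i x_i s(eps(y_i))
   is a normalized left integral.  Conversely, if l is a normalized left
   integral, then e = alpha_r^-1 (1 (x) l) is a separability element: both u e
   and e u are sent by alpha_r to u (x) l, and contracting
   alpha_r e = 1 (x) l with the counit gives \sum_i x_i y_i = t (eps l) = 1.
   Normalized left integrals are the images of 1 under the U-linear sections
   of eps.  Averaging an A-linear section by e shows that every module is
   relatively projective, and relative projectivity of A splits eps, as s is
   an A-linear section of it. *)
Require Import Defs.
From HB Require Import structures.
From mathcomp Require Import all_boot all_order all_algebra.
Import GRing.Theory.
Local Open Scope ring_scope.

Set Implicit Arguments.
Unset Strict Implicit.
Unset Printing Implicit Defensive.

(** * Additive maps out of a balanced tensor product *)

Section TensorTheory.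
Variables (I : Type) (M N : zmodType) (ra : M -> I -> M) (la : I -> N -> N).
Local Notation T := (tensor ra la).

(** Pure tensors generate [T] additively. Identities of additive maps are checked through this
    principle below. *)
Lemma eq_additive_tens (Z : zmodType) (F G : T -> Z) :
    {morph F : x y / x + y} -> {morph G : x y / x + y} ->
  (forall m n, F (tens ra la m n) = G (tens ra la m n)) -> F =1 G.
Proof.
move=> FD GD FG.
have add0 (K : T -> Z) : {morph K : x y / x + y} -> K 0 = 0.
  by move=> KD; apply: (addrI (K 0)); rewrite -KD !addr0.
elim/tensor_ind => [|m n x IHx]; first by rewrite !add0.
by rewrite FD GD FG IHx.
Qed.

(** All three lifts sum over the same chosen representative of [x]. *)
Lemma tensor_lift_add (Z : zmodType) (f g : M -> N -> Z) (x : T) :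
  tensor_lift (fun m n => f m n + g m n) x = tensor_lift f x + tensor_lift g x.
Proof. exact: big_split. Qed.

Lemma eq_tensor_lift (Z : zmodType) (f g : M -> N -> Z) (x : T) :
  (forall m n, f m n = g m n) -> tensor_lift f x = tensor_lift g x.
Proof. by move=> fg; apply: eq_bigr => p _; apply: fg. Qed.

End TensorTheory.

(** * The bimodule [ext_tensor f], separability elements and averaging *)

Section Extension.
Variables (k : comPzRingType) (A U : algType k) (f : {lrmorphism A -> U}).
Local Notation E := (ext_tensor f).
Local Notation "x ** y" := (tens (btri_r f) (tri_l f) x y) (at level 40).

Lemma ext_lact_balanced u :
  balanced (btri_r f) (tri_l f) (fun x y => u * x ** y).
Proof.
split=> [x x' y|x y y'|x a y]; rewrite ?mulrDr ?tensDl ?tensDr //.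
by rewrite /btri_r mulrA tens_bal.
Qed.

Lemma ext_ract_balanced v :
  balanced (btri_r f) (tri_l f) (fun x y => x ** (y * v)).
Proof.
split=> [x x' y|x y y'|x a y]; rewrite ?mulrDl ?tensDl ?tensDr //.
by rewrite /tri_l -mulrA tens_bal.
Qed.

Lemma ext_mul_balanced : balanced (btri_r f) (tri_l f) (fun x y => x * y).
Proof.
split=> [x x' y|x y y'|x a y]; rewrite ?mulrDl ?mulrDr //.
by rewrite /tri_l /btri_r mulrA.
Qed.

Lemma ext_lactE u x y : ext_lact u (x ** y : E) = u * x ** y.
Proof. exact: (tensor_liftE (ext_lact_balanced u)). Qed.

Lemma ext_ractE x y v : ext_ract (x ** y : E) v = x ** (y * v).
Proof. exact: (tensor_liftE (ext_ract_balanced v)). Qed.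

Lemma ext_mulE x y : ext_mul (x ** y : E) = x * y.
Proof. exact: (tensor_liftE ext_mul_balanced). Qed.

Lemma ext_lactD u : {morph ext_lact u : z z' / z + z' : E}.
Proof. exact: (tensor_liftD (ext_lact_balanced u)). Qed.

Lemma ext_ractD v : {morph (fun z : E => ext_ract z v) : z z' / z + z'}.
Proof. exact: (tensor_liftD (ext_ract_balanced v)). Qed.

Lemma ext_mulD : {morph (@ext_mul _ _ _ f) : z z' / z + z'}.
Proof. exact: (tensor_liftD ext_mul_balanced). Qed.

Lemma ext_lactDl (z : E) : {morph (fun u => ext_lact u z) : u v / u + v}.
Proof.
move=> u v; rewrite -tensor_lift_add; apply: eq_tensor_lift => x y.
by rewrite mulrDl tensDl.
Qed.

Lemma ext_lactM u v (z : E) : ext_lact (u * v) z = ext_lact u (ext_lact v z).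
Proof.
move: z; apply: eq_additive_tens => [z z'|z z'|x y]; rewrite ?ext_lactD //.
by rewrite !ext_lactE mulrA.
Qed.

Lemma ext_lact_ract u v (z : E) :
  ext_lact u (ext_ract z v) = ext_ract (ext_lact u z) v.
Proof.
move: z; apply: eq_additive_tens => [z z'|z z'|x y].
- by rewrite ext_ractD ext_lactD.
- by rewrite ext_lactD ext_ractD.
by rewrite ext_lactE !ext_ractE ext_lactE.
Qed.

Lemma ext_mul_lact u (z : E) : ext_mul (ext_lact u z) = u * ext_mul z.
Proof.
move: z; apply: eq_additive_tens => [z z'|z z'|x y].
- by rewrite ext_lactD ext_mulD.
- by rewrite ext_mulD mulrDr.
by rewrite ext_lactE !ext_mulE mulrA.
Qed.

Definition separability_element (e : E) : Prop :=
  (forall u, ext_lact u e = ext_ract e u) /\ ext_mul e = 1.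

(** A bimodule section is determined by its value at 1; conversely [e] gives the section
    [u |-> u e], right linear because [e] is central. *)
Lemma separable_extensionP :
  separable_extension f <-> exists e, separability_element e.
Proof.
split=> [[sigma [sl sr sK]]|[e [eC e1]]].
  by exists (sigma 1); split=> [u|//]; rewrite -sl -sr mulr1 mul1r.
have lact0 : ext_lact 0 e = 0.
  by apply: (addrI (ext_lact 0 e)); rewrite -ext_lactDl !addr0.
pose sigma_add := GRing.isNmodMorphism.Build U E (fun u => ext_lact u e)
  (conj lact0 (ext_lactDl e)).
pose sigma : {additive U -> E} := HB.pack (fun u => ext_lact u e) sigma_add.
exists sigma; split=> [u x|x v|x] /=.
- exact: ext_lactM.
- by rewrite ext_lactM eC ext_lact_ract.
- by rewrite ext_mul_lact e1 mulr1.
Qed.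

Lemma separable_relatively_projective :
  separable_extension f -> forall M : lmodType U, relatively_projective f M.
Proof.
case/separable_extensionP=> e [eC e1] M N P p j jA jK g.
(* Summed over [e], this is the average of [j \o g]; it is balanced because [j] is linear over
   [A]. *)
pose av m x y := x *: j (g (y *: m)).
have avB m : balanced (btri_r f) (tri_l f) (av m).
  split=> [x x' y|x y y'|x a y]; rewrite /av.
  - by rewrite scalerDl.
  - by rewrite scalerDl !raddfD.
  - by rewrite /btri_r /tri_l -!scalerA [g (f a *: _)]linearZ jA.
have av_lact u m z :
    tensor_lift (av m) (ext_lact u z : E) = u *: tensor_lift (av m) z.
  move: z; apply: eq_additive_tens => [z z'|z z'|x y].
  - by rewrite ext_lactD (tensor_liftD (avB m)).
  - by rewrite (tensor_liftD (avB m)) scalerDr.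
  by rewrite ext_lactE !(tensor_liftE (avB m)) /av scalerA.
have av_ract u m z :
    tensor_lift (av m) (ext_ract z u : E) = tensor_lift (av (u *: m)) z.
  move: z; apply: eq_additive_tens => [z z'|z z'|x y].
  - by rewrite ext_ractD (tensor_liftD (avB m)).
  - by rewrite (tensor_liftD (avB _)).
  by rewrite ext_ractE !(tensor_liftE (avB _)) /av scalerA.
have p_av m z : p (tensor_lift (av m) (z : E)) = ext_mul z *: g m.
  move: z; apply: eq_additive_tens => [z z'|z z'|x y].
  - by rewrite (tensor_liftD (avB m)) linearD.
  - by rewrite ext_mulD scalerDl.
  by rewrite ext_mulE (tensor_liftE (avB m)) /av linearZ_LR jK [g _]linearZ_LR scalerA.
pose h m := tensor_lift (av m) e.
have h_lin : linear h.
  (* Linearity over [U] is the centrality [u e = e u]: the left factor [u] moves through [e] onto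
     [m]. *)
  move=> u m m'; rewrite /h -av_lact eC av_ract -tensor_lift_add.
  by apply: eq_tensor_lift => x y; rewrite /av scalerDr !raddfD.
pose hL := GRing.isLinear.Build U M N *:%R h h_lin.
exists (HB.pack h hL : {linear M -> N}) => m /=.
by rewrite p_av e1 scale1r.
Qed.

End Extension.

(** * Normalized integrals and sections of the counit *)

Section LeftBialgebroid.
Variables (k : comPzRingType) (A U : algType k) (H : left_bialgebroid A U).
Local Notation s := (src H).
Local Notation t := (tgt H).
Local Notation eps := (counit H).
Local Notation comul := (comul H).
Local Notation E := (ext_tensor s).
Local Notation T := (tensor (tri_r t) (tri_l s)).
Local Notation "x ** y" := (tens (btri_r s) (tri_l s) x y) (at level 40).
Local Notation "x ## y" := (tens (tri_r t) (tri_l s) x y) (at level 40).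

Lemma counit_of_src a : eps (s a) = a.
Proof. by rewrite -[s a]mulr1 counit_src counit1 mulr1. Qed.

Lemma normalized_integral_of_separable :
  separable_extension s -> exists l, left_integral H l /\ eps l = 1.
Proof.
case/separable_extensionP=> e [eC e1].
(* The counit on the second factor, followed by the identification of [U] tensored with [A] over [A]
   with [U]. *)
pose c x y := x * s (eps y).
have cB : balanced (btri_r s) (tri_l s) c.
  split=> [x x' y|x y y'|x a y]; rewrite /c.
  - by rewrite mulrDl.
  - by rewrite !raddfD mulrDr.
  - by rewrite /btri_r /tri_l counit_src rmorphM mulrA.
have c_lact u z : tensor_lift c (ext_lact u z : E) = u * tensor_lift c z.
  move: z; apply: eq_additive_tens => [z z'|z z'|x y].
  - by rewrite ext_lactD (tensor_liftD cB).
  - by rewrite (tensor_liftD cB) mulrDr.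
  by rewrite ext_lactE !(tensor_liftE cB) /c mulrA.
have c_ract u z :
    tensor_lift c (ext_ract z u : E) = tensor_lift c (ext_ract z (s (eps u))).
  move: z; apply: eq_additive_tens => [z z'|z z'|x y].
  - by rewrite ext_ractD (tensor_liftD cB).
  - by rewrite ext_ractD (tensor_liftD cB).
  by rewrite !ext_ractE !(tensor_liftE cB) /c counitM_src.
have eps_c z : eps (tensor_lift c (z : E)) = eps (ext_mul z).
  move: z; apply: eq_additive_tens => [z z'|z z'|x y].
  - by rewrite (tensor_liftD cB) raddfD.
  - by rewrite ext_mulD raddfD.
  by rewrite ext_mulE (tensor_liftE cB) /c -counitM_src.
exists (tensor_lift c e); split=> [u|]; last by rewrite eps_c e1 counit1.
(* With [l = c(e)]: [u l = c(e u) = c(e s(eps u)) = s(eps u) l]. *)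
by rewrite -!c_lact !eC c_ract.
Qed.

Lemma counit_splits_of_integral l :
  left_integral H l -> eps l = 1 -> counit_splits H.
Proof.
move=> lI l1; pose sg (a : base_module H) : U^o := s a * l.
have sg_lin : linear sg.
  move=> u a b; rewrite /sg rmorphD mulrDl; congr (_ + _).
  (* The integral property is applied to [u * s a], whose counit is the action of [u] on [a]. *)
  by rewrite -[RHS]/(u * (s a * l)) mulrA [RHS]lI.
pose sgL := GRing.isLinear.Build U (base_module H) U^o *:%R sg sg_lin.
exists (HB.pack sg sgL : {linear base_module H -> U^o}) => a /=.
by rewrite /sg counit_src l1 mulr1.
Qed.

Lemma integral_of_counit_splits :
  counit_splits H -> exists l, left_integral H l /\ eps l = 1.
Proof.
case=> sg sgK; exists (sg 1); split=> // u.
have act1 v : v * sg 1 = sg (eps v).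
  rewrite -[v * _]/(v *: (sg 1 : U^o)) -linearZ; congr (sg _).
  by rewrite -[LHS]/(eps (v * s 1)) rmorph1 mulr1.
(* Both sides equal [sg (eps u)], as [u] and [s (eps u)] have the same counit. *)
by rewrite !act1 counit_of_src.
Qed.

Lemma counit_splits_of_relatively_projective :
  relatively_projective s (base_module H) -> counit_splits H.
Proof.
have eps_lin : linear (eps : U^o -> base_module H).
  by move=> u x y; rewrite raddfD -[_ *: x]/(u * x) counitM_src.
pose epsL := GRing.isLinear.Build U U^o (base_module H) *:%R eps eps_lin.
pose p : {linear U^o -> base_module H} :=
  HB.pack (eps : U^o -> base_module H) epsL.
have s_add : nmod_morphism (s : base_module H -> U^o).
  by split=> [|a b]; rewrite ?raddf0 ?raddfD.
pose sA := GRing.isNmodMorphism.Build (base_module H) U^o s s_add.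
pose j : {additive base_module H -> U^o} :=
  HB.pack (s : base_module H -> U^o) sA.
move=> projA.
have jA a (y : base_module H) : j (s a *: y) = s a *: j y.
  rewrite -[LHS]/(s (eps (s a * s y))) -[RHS]/(s a * s y).
  by rewrite -rmorphM counit_of_src.
(* Lifting the identity of [A] along the counit gives the section. *)
have [h hK] := projA _ _ p j jA counit_of_src idfun.
by exists h => a; apply: hK.
Qed.

(** * Factorwise multiplication and the map [alpha_r] *)

Definition tensor_rmul (v w : U) : T -> T :=
  tensor_lift (fun x y => x * v ## (y * w)).

Lemma tensor_rmul_balanced v w :
  balanced (tri_r t) (tri_l s) (fun x y => x * v ## (y * w)).
Proof.
split=> [x x' y|x y y'|x a y]; rewrite ?mulrDl ?tensDl ?tensDr //.
by rewrite /tri_r /tri_l -!mulrA -tens_bal.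
Qed.

Lemma tensor_rmulE v w x y : tensor_rmul v w (x ## y) = x * v ## (y * w).
Proof. exact: (tensor_liftE (tensor_rmul_balanced v w)). Qed.

Lemma tensor_rmulD v w : {morph tensor_rmul v w : z z' / z + z'}.
Proof. exact: (tensor_liftD (tensor_rmul_balanced v w)). Qed.

Lemma tensor_rmulDl v v' w z :
  tensor_rmul (v + v') w z = tensor_rmul v w z + tensor_rmul v' w z.
Proof.
rewrite -tensor_lift_add; apply: eq_tensor_lift => x y.
by rewrite mulrDr tensDl.
Qed.

Lemma tensor_rmulDr v w w' z :
  tensor_rmul v (w + w') z = tensor_rmul v w z + tensor_rmul v w' z.
Proof.
rewrite -tensor_lift_add; apply: eq_tensor_lift => x y.
by rewrite mulrDr tensDr.
Qed.

Lemma tensor_rmulM v w v' w' z :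
  tensor_rmul v' w' (tensor_rmul v w z) = tensor_rmul (v * v') (w * w') z.
Proof.
move: z; apply: eq_additive_tens => [z z'|z z'|x y]; rewrite ?tensor_rmulD //.
by rewrite !tensor_rmulE !mulrA.
Qed.

(* Left multiplication by [comul u]; well defined by the Takeuchi condition. *)
Definition comul_lmul (u : U) : T -> T :=
  tensor_lift (fun v w => tensor_rmul v w (comul u)).

Lemma comul_lmul_balanced u :
  balanced (tri_r t) (tri_l s) (fun v w => tensor_rmul v w (comul u)).
Proof.
split=> [v v' w|v w w'|v a w]; rewrite ?tensor_rmulDl ?tensor_rmulDr //.
(* The Takeuchi condition, read as an equality of right multiplications. *)
have tE : tensor_rmul (t a) 1 (comul u) = tensor_rmul 1 (s a) (comul u).
  transitivity (tensor_lift (fun x y => x * t a ## y) (comul u)).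
    by apply: eq_tensor_lift => x y; rewrite mulr1.
  by rewrite comul_takeuchi; apply: eq_tensor_lift => x y; rewrite mulr1.
by rewrite /tri_r /tri_l -[w in LHS]mul1r -[v in RHS]mul1r -!tensor_rmulM tE.
Qed.

Lemma comul_lmulE u v w : comul_lmul u (v ## w) = tensor_rmul v w (comul u).
Proof. exact: (tensor_liftE (comul_lmul_balanced u)). Qed.

Lemma comul_lmulD u : {morph comul_lmul u : z z' / z + z'}.
Proof. exact: (tensor_liftD (comul_lmul_balanced u)). Qed.

Lemma comul_mul u v : comul (u * v) = comul_lmul u (comul v).
Proof. exact: comulM. Qed.

Lemma comul_of_src a : comul (s a) = s a ## 1.
Proof.
rewrite -[s a in LHS]mulr1 comul_src comul1 tensor_liftE ?mulr1 //.
(* Balancedness holds because the images of [s] and [t] commute. *)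
split=> [x x' y|x y y'|x b y]; rewrite ?mulrDr ?tensDl ?tensDr //.
by rewrite /tri_r mulrA src_tgtC -mulrA -tens_bal.
Qed.

Lemma alpha_r_balanced :
  balanced (btri_r s) (tri_l s) (fun u v => tensor_rmul v 1 (comul u)).
Proof.
split=> [u u' v|u v v'|u a v].
- by rewrite raddfD tensor_rmulD.
- exact: tensor_rmulDl.
- by rewrite /btri_r /tri_l comul_mul comul_of_src comul_lmulE tensor_rmulM mulr1.
Qed.

Lemma alpha_r_rmul : @alpha_r _ _ _ H =1
  tensor_lift (fun u v => tensor_rmul v 1 (comul u)).
Proof.
move=> z; apply: eq_tensor_lift => u v.
by apply: eq_tensor_lift => x y; rewrite mulr1.
Qed.

Lemma alpha_rE u v : alpha_r (u ** v) = tensor_rmul v 1 (comul u).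
Proof. by rewrite alpha_r_rmul (tensor_liftE alpha_r_balanced). Qed.

Lemma alpha_rD : {morph @alpha_r _ _ _ H : z z' / z + z'}.
Proof. by move=> z z'; rewrite !alpha_r_rmul (tensor_liftD alpha_r_balanced). Qed.

(** Multiplicativity of [comul], together with the fact that left multiplication by [comul u]
    commutes with right multiplications. *)
Lemma alpha_r_lact u (z : E) : alpha_r (ext_lact u z) = comul_lmul u (alpha_r z).
Proof.
move: z; apply: eq_additive_tens => [z z'|z z'|x y].
- by rewrite ext_lactD alpha_rD.
- by rewrite alpha_rD comul_lmulD.
rewrite ext_lactE !alpha_rE comul_mul.
move: (comul x); apply: eq_additive_tens => [z z'|z z'|v w].
- by rewrite comul_lmulD tensor_rmulD.
- by rewrite tensor_rmulD comul_lmulD.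
by rewrite comul_lmulE tensor_rmulM tensor_rmulE comul_lmulE.
Qed.

Lemma alpha_r_ract (z : E) v :
  alpha_r (ext_ract z v) = tensor_rmul v 1 (alpha_r z).
Proof.
move: z; apply: eq_additive_tens => [z z'|z z'|x y].
- by rewrite ext_ractD alpha_rD.
- by rewrite alpha_rD tensor_rmulD.
by rewrite ext_ractE !alpha_rE tensor_rmulM mulr1.
Qed.

(** * Contraction with the counit, and separability from an integral *)

Definition counit_contract : T -> U :=
  tensor_lift (fun x y => t (eps y) * x).

Lemma counit_contract_balanced :
  balanced (tri_r t) (tri_l s) (fun x y => t (eps y) * x).
Proof.
split=> [x x' y|x y y'|x a y]; first by rewrite mulrDr.
  by rewrite !raddfD mulrDl.
by rewrite /tri_r /tri_l counit_src tgtM mulrA.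
Qed.

Lemma counit_contractE x y : counit_contract (x ## y) = t (eps y) * x.
Proof. exact: (tensor_liftE counit_contract_balanced). Qed.

Lemma counit_contractD : {morph counit_contract : z z' / z + z'}.
Proof. exact: (tensor_liftD counit_contract_balanced). Qed.

Lemma counit_contract_comul u : counit_contract (comul u) = u.
Proof. exact: comul_counitr. Qed.

Lemma counit_contract_rmul v z :
  counit_contract (tensor_rmul v 1 z) = counit_contract z * v.
Proof.
move: z; apply: eq_additive_tens => [z z'|z z'|x y].
- by rewrite tensor_rmulD counit_contractD.
- by rewrite counit_contractD mulrDl.
by rewrite tensor_rmulE !counit_contractE mulr1 mulrA.
Qed.

Lemma counit_contract_alpha_r (z : E) : counit_contract (alpha_r z) = ext_mul z.
Proof.
move: z; apply: eq_additive_tens => [z z'|z z'|x y].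
- by rewrite alpha_rD counit_contractD.
- exact: ext_mulD.
by rewrite alpha_rE ext_mulE counit_contract_rmul counit_contract_comul.
Qed.

(** On a pure tensor, [x ## y l = x ## s(eps y) l = t(eps y) x ## l]. *)
Lemma tensor_rmul_integral l z : left_integral H l ->
  tensor_rmul 1 l z = counit_contract z ## l.
Proof.
move=> lI; move: z; apply: eq_additive_tens => [z z'|z z'|x y].
- exact: tensor_rmulD.
- by rewrite counit_contractD tensDl.
by rewrite tensor_rmulE counit_contractE mulr1 lI -tens_bal.
Qed.

Lemma separable_of_integral l :
  right_hopf H -> left_integral H l -> eps l = 1 -> separable_extension s.
Proof.
case=> beta alphaK betaK lI l1; apply/separable_extensionP.
exists (beta (1 ## l)); split=> [u|].
  (* Injectivity of [alpha_r] reduces centrality to both images being [u ## l]. *)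
  apply: (can_inj alphaK); rewrite alpha_r_lact alpha_r_ract !betaK comul_lmulE.
  by rewrite tensor_rmul_integral // counit_contract_comul tensor_rmulE mul1r mulr1.
by rewrite -counit_contract_alpha_r betaK counit_contractE l1 tgt1 mulr1.
Qed.

End LeftBialgebroid.

Theorem proposition2p4p5 (k : comPzRingType) (A U : algType k)
    (H : left_bialgebroid A U) (H_right_hopf : right_hopf H) :
  [<-> separable_extension (src H);
       exists l : U, left_integral H l /\ counit H l = 1;
       counit_splits H;
       forall M : lmodType U, relatively_projective (src H) M].
Proof.
tfae.
- exact: normalized_integral_of_separable.
- by case=> l [lI l1]; apply: counit_splits_of_integral lI l1.
(* The right Hopf hypothesis enters here, turning the integral into a separability element. *)
- case/integral_of_counit_splits=> l [lI l1].
  exact/separable_relatively_projective/(separable_of_integral _ lI l1).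
(* Projectivity is applied to the module [A] alone. *)
- move=> /(_ (base_module H))/counit_splits_of_relatively_projective.
  case/integral_of_counit_splits=> l [lI l1].
  exact: separable_of_integral lI l1.
Qed.
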